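(* Let $K\in\mathcal{K}^2$ and $\rho>0$. (Diameter) For any bisection $(K_1,K_2)$ of $K$ with $\max\{\mathrm{D}(K_1),\mathrm{D}(K_2)\}=\rho$, there exists a bisection $(K_1',K_2')$ of $K$ given by a line segment (i.e. $K_1'\cap K_2'$ is a line segment) with $\max\{\mathrm{D}(K_1'),\mathrm{D}(K_2')\}\leq\rho$. (Width) Likewise, for any bisection $(K_1,K_2)$ of $K$ with $\max\{\mathrm{w}(K_1),\mathrm{w}(K_2)\}=\rho$, there exists a bisection $(K_1',K_2')$ of $K$ given by a line segment with $\max\{\mathrm{w}(K_1'),\mathrm{w}(K_2')\}\leq\rho$.
   Context: $\mathcal{K}^2$ is the family of planar convex bodies (compact convex subsets of $\mathbb{R}^2$) with non-empty interior. For a compact set $S\subset\mathbb{R}^2$, $\mathrm{D}(S)$ is its diameter (largest Euclidean distance between two points of $S$) and $\mathrm{w}(S)$ its (minimum) width, i.e. the shortest distance between two parallel lines containing $S$ between them. A bisection of $K\in\mathcal{K}^2$ is a pair of closed sets $(K_1,K_2)$ such that (i) $K=K_1\cup K_2$, and (ii) $K_1\cap K_2=l([-1,1])$, where $l:[-1,1]\to K$ is an injective continuous curve whose endpoints $l(-1),l(1)$ are the only points of the curve lying in the boundary of $K$. *)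

(* Defs.v *)
From mathcomp Require Import all_boot all_order all_algebra.
From mathcomp Require Import all_classical all_reals all_analysis.

Set Implicit Arguments.
Unset Strict Implicit.
Unset Printing Implicit Defensive.

Import Order.TTheory GRing.Theory Num.Theory.
Import numFieldNormedType.Exports.

Local Open Scope classical_set_scope.
Local Open Scope ring_scope.

(* The library norm `|x| on 'rV[R]_2 is the sup norm. It induces the usual
   topology, used below for compact, closed, interior and continuous, but
   lengths must be measured with the Euclidean norm. *)
Definition dot (R : realType) (x y : 'rV[R]_2) : R :=
  \sum_(i < 2) x 0 i * y 0 i.

Definition enorm (R : realType) (x : 'rV[R]_2) : R := Num.sqrt (dot x x).

Definition edist (R : realType) (x y : 'rV[R]_2) : R := enorm (x - y).

Definition boundary (R : realType) (S : set 'rV[R]_2) : set 'rV[R]_2 :=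
  closure S `\` interior S.

Definition segment (R : realType) (p q : 'rV[R]_2) : set 'rV[R]_2 :=
  [set (1 - t) *: p + t *: q | t in `[0, 1]%classic].

Definition convex_body (R : realType) (K : set 'rV[R]_2) : Prop :=
  [/\ compact K, convex_set K & interior K !=set0].

(* For compact nonempty S this supremum is attained. *)
Definition diameter (R : realType) (S : set 'rV[R]_2) : R :=
  sup [set d | exists x y, [/\ S x, S y & d = edist x y]].

(* With u a unit vector, dot u x = a and dot u x = b are parallel lines at
   distance b - a; they may coincide, as for S contained in a line. For compact
   nonempty S the infimum is attained. *)
Definition width (R : realType) (S : set 'rV[R]_2) : R :=
  inf [set d | exists (u : 'rV[R]_2) (a b : R),
    [/\ enorm u = 1, a <= b, (forall x, S x -> a <= dot u x <= b)
      & d = b - a]].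

(* Only the restriction of l to [-1, 1] matters. *)
Definition dividing_curve (R : realType) (K : set 'rV[R]_2)
    (l : R -> 'rV[R]_2) : Prop :=
  [/\ {within `[-1, 1], continuous l},
      {in `[-1, 1] &, injective l},
      l @` `[-1, 1]%classic `<=` K
    & forall t, t \in `[-1, 1] -> boundary K (l t) <-> t = -1 \/ t = 1].

Definition bisection (R : realType) (K K1 K2 : set 'rV[R]_2) : Prop :=
  [/\ closed K1, closed K2, K = K1 `|` K2
    & exists l : R -> 'rV[R]_2,
        dividing_curve K l /\ K1 `&` K2 = l @` `[-1, 1]%classic].

Definition segment_bisection (R : realType) (K K1 K2 : set 'rV[R]_2) : Prop :=
  bisection K K1 K2 /\ exists p q, K1 `&` K2 = segment p q.

(* Main.v *)
(* Let p and q be the ends of the dividing curve. It meets the boundary of K only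
   at p and q, so each of the two open boundary arcs between p and q, being
   connected and covered by the closed sets K1 and K2, lies in one of them; the
   arcs are parametrized by radial projection from an interior point c off the
   line pq. No separation theorem for the curve is needed. A chord of K parallel
   to pq on one side of the line has both ends on the same arc. Hence, if K has
   points on the side of pq opposite to c, each part of K cut off by pq consists
   of points of segments with ends in K1 (or all of them in K2), and passing to
   such segments changes neither diameter nor width. Otherwise pq is in the
   boundary, all of K is covered in this way by K1 or by K2, and any chord will
   do. *)
Require Import Defs.
From mathcomp Require Import all_boot all_order all_algebra.
From mathcomp Require Import all_classical all_reals all_analysis.
From mathcomp Require Import ring lra.

Set Implicit Arguments.
Unset Strict Implicit.
Unset Printing Implicit Defensive.

Import Order.TTheory GRing.Theory Num.Theory.
Import numFieldNormedType.Exports.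

Local Open Scope classical_set_scope.
Local Open Scope ring_scope.

(** * Convex combinations, interior and boundary in the plane *)

Definition cross (R : realType) (u v : 'rV[R]_2) : R :=
  u 0 0 * v 0 1 - u 0 1 * v 0 0.

Lemma rV2P (R : realType) (x y : 'rV[R]_2) :
  x 0 0 = y 0 0 -> x 0 1 = y 0 1 -> x = y.
Proof.
move=> h0 h1; apply/rowP => i.
have [->|->] // : i = 0 \/ i = 1.
by case: i => [[|[|//]] Hi]; [left|right]; apply/val_inj.
Qed.

Lemma convex_comb (R : realType) (K : set 'rV[R]_2) (x y : 'rV[R]_2) (a b : R) :
  convex_set K -> K x -> K y -> 0 <= a -> 0 <= b -> a + b = 1 ->
  K (a *: x + b *: y).
Proof.
move=> cK Kx Ky a0 b0 ab.
have h : (0 <= a) && (a <= 1) by apply/andP; split; lra.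
have -> : b = 1 - a by lra.
have := cK x y (Itv01 (proj1 (andP h)) (proj2 (andP h))) (mem_set Kx) (mem_set Ky).
by rewrite inE.
Qed.

Lemma nbhs_rV2 (R : realType) (K : set 'rV[R]_2) (x : 'rV[R]_2) :
  nbhs x K <-> exists2 r : R, 0 < r & forall y, `|x - y| < r -> K y.
Proof.
split => [/(@nbhs_normP R ('rV[R]_2 : normedModType R)) [r /= r0 H]|[r r0 H]].
  by exists r.
by apply/(@nbhs_normP R ('rV[R]_2 : normedModType R)); exists r.
Qed.

Lemma interiorP (R : realType) (K : set 'rV[R]_2) (x : 'rV[R]_2) :
  interior K x <-> exists2 r : R, 0 < r & forall v, `|v| < r -> K (x + v).
Proof.
rewrite /interior /=; split => [/nbhs_rV2 [r r0 H]|[r r0 H]].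
  exists r => // v vr; apply: H.
  by rewrite opprD addrA subrr sub0r normrN.
apply/nbhs_rV2; exists r => //= y xy.
have -> : y = x + (y - x) by rewrite addrC subrK.
by apply: H; rewrite distrC.
Qed.
(** Shrinking by the factor [a] towards [y] turns a ball around [x] inside [K] into a ball around
    [z] inside [K]. The equation for [z] is a hypothesis, so that each use leaves a coordinatewise
    identity to [ring] or [field]. *)
Lemma interior_comb (R : realType) (K : set 'rV[R]_2) (x y z : 'rV[R]_2)
    (a b : R) :
  convex_set K -> interior K x -> K y -> 0 < a -> 0 <= b -> a + b = 1 ->
  z = a *: x + b *: y -> interior K z.
Proof.
move=> cK /interiorP [r r0 H] Ky a0 b0 ab ->.
apply/interiorP; exists (a * r); first exact: mulr_gt0.
move=> v va.
have -> : a *: x + b *: y + v = a *: (x + a^-1 *: v) + b *: y.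
  by rewrite scalerDr scalerA divff ?gt_eqF// scale1r addrAC.
apply: convex_comb => //; last exact: ltW.
by apply: H; rewrite normrZ gtr0_norm ?invr_gt0// ltr_pdivrMl.
Qed.

Lemma boundary_closed (R : realType) (K : set 'rV[R]_2) (x : 'rV[R]_2) :
  closed K -> boundary K x <-> K x /\ ~ interior K x.
Proof. by move=> /closure_id cK; rewrite /boundary -cK. Qed.

Lemma body_closed (R : realType) (K : set 'rV[R]_2) : convex_body K -> closed K.
Proof. by case=> cK _ _; apply: compact_closed => //; exact: norm_hausdorff. Qed.

Lemma body_bounded (R : realType) (K : set 'rV[R]_2) :
  convex_body K -> exists2 M : R, 0 < M & forall x, K x -> `|x| <= M.
Proof.
case=> /compact_bounded [M [Mr H]] _ _.
exists (`|M| + 1); first by rewrite ltr_wpDl.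
move=> x Kx; apply: (H (`|M| + 1)) => //.
by rewrite (le_lt_trans (ler_norm M))// ltrDl.
Qed.

(** * The Minkowski functional of [K] about [c], and radial projection to the boundary *)

Definition gauge (R : realType) (K : set 'rV[R]_2) (c v : 'rV[R]_2) : R :=
  inf [set s | 0 < s /\ K (c + s^-1 *: v)].

Lemma gauge_le (R : realType) (K : set 'rV[R]_2) (c v : 'rV[R]_2) (s : R) :
  0 < s -> K (c + s^-1 *: v) -> gauge K c v <= s.
Proof. by move=> s0 Ks; apply: ge_inf => //; exists 0 => t [/ltW]. Qed.

Lemma gauge_lt (R : realType) (K : set 'rV[R]_2) (c v : 'rV[R]_2) (s : R) :
  convex_set K -> interior K c -> gauge K c v < s -> K (c + s^-1 *: v).
Proof.
move=> cK ic hs.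
have Kc := interior_subset ic.
have [t [t0 Kt] ts] : exists2 t, 0 < t /\ K (c + t^-1 *: v) & t < s.
  (* The infimum is over a nonempty set: the scale below displaces [c] by a vector of norm [r / 2],
     which stays in the ball of radius [r]. *)
  have [r r0 H] := (interiorP _ _).1 ic.
  apply: inf_lt => //.
  have [->|v0] := eqVneq v 0; first by exists 1; split => //; rewrite scaler0 addr0.
  have nv : 0 < `|v| by rewrite normr_gt0.
  exists (2 * `|v| / r); split; first by rewrite divr_gt0// mulr_gt0.
  apply: H; rewrite normrZ gtr0_norm ?invr_gt0 ?divr_gt0 ?mulr_gt0//.
  rewrite -[ltLHS](_ : r / 2 = _); last by field; rewrite !gt_eqF.
  by rewrite ltr_pdivrMr// ltr_pMr// ltr1n.
have s0 : 0 < s := lt_trans t0 ts.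
have -> : c + s^-1 *: v = (t / s) *: (c + t^-1 *: v) + (1 - t / s) *: c.
  apply/rowP => i; rewrite !mxE; field; by rewrite !gt_eqF.
apply: convex_comb => //; last by ring.
  by rewrite divr_ge0// ltW.
by rewrite subr_ge0 ler_pdivrMr// mul1r ltW.
Qed.

(** This is boundedness: a vanishing gauge would put into [K] a point at distance [3 * M] from [c],
    while points of norm at most [M] are at distance at most [2 * M]. *)
Lemma gauge_gt0 (R : realType) (K : set 'rV[R]_2) (c v : 'rV[R]_2) :
  convex_body K -> interior K c -> v != 0 -> 0 < gauge K c v.
Proof.
move=> bK ic v0; have [M M0 HM] := body_bounded bK.
case: (bK) => _ cK _.
have nv : 0 < `|v| by rewrite normr_gt0.
have d0 : 0 < `|v| / (2 * M) by rewrite divr_gt0// mulr_gt0.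
rewrite ltNge; apply/negP => g0.
have g1 : gauge K c v < `|v| / (3 * M) by rewrite (le_lt_trans g0)// divr_gt0// mulr_gt0.
have s0 : 0 < `|v| / (3 * M) by rewrite divr_gt0// mulr_gt0.
have /HM h1 := gauge_lt cK ic g1.
have /HM h2 := interior_subset ic.
have : `|(`|v| / (3 * M))^-1 *: v| <= M + M.
  have -> : (`|v| / (3 * M))^-1 *: v = (c + (`|v| / (3 * M))^-1 *: v) - c.
    by rewrite addrAC subrr add0r.
  by rewrite (le_trans (ler_normB _ _))// lerD.
rewrite normrZ gtr0_norm ?invr_gt0//.
rewrite -[leLHS](_ : 3 * M = _); last by field; rewrite !gt_eqF.
lra.
Qed.

Lemma gaugeD (R : realType) (K : set 'rV[R]_2) (c v w : 'rV[R]_2) :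
  convex_set K -> interior K c ->
  gauge K c (v + w) <= gauge K c v + gauge K c w.
Proof.
move=> cK ic.
have g0 u : 0 <= gauge K c u.
  have [[s hs]|hN] := pselect ([set s | 0 < s /\ K (c + s^-1 *: u)] !=set0).
    by apply: lb_le_inf; [exists s|move=> t [/ltW]].
  (* The infimum of the empty set is 0 by convention. *)
  rewrite /gauge (_ : [set s | _] = set0) ?inf0//.
  by apply/seteqP; split => // t ht; apply: hN; exists t.
apply/ler_addgt0Pr => e e0.
(* The added [e / 2] makes [s] and [t] admissible and positive. The point for [v + w] at scale
   [s + t] is then a convex combination of the two points at scales [s] and [t]. *)
set s := gauge K c v + e / 2; set t := gauge K c w + e / 2.
have -> : gauge K c v + gauge K c w + e = s + t by rewrite /s /t; field.
have s0 : 0 < s by rewrite ltr_wpDl// divr_gt0.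
have t0 : 0 < t by rewrite ltr_wpDl// divr_gt0.
have Ks : K (c + s^-1 *: v) by apply: gauge_lt => //; rewrite ltrDl divr_gt0.
have Kt : K (c + t^-1 *: w) by apply: gauge_lt => //; rewrite ltrDl divr_gt0.
apply: gauge_le; first exact: addr_gt0.
have st0 : 0 < s + t by exact: addr_gt0.
have -> : c + (s + t)^-1 *: (v + w)
    = (s / (s + t)) *: (c + s^-1 *: v) + (t / (s + t)) *: (c + t^-1 *: w).
  apply/rowP => i; rewrite !mxE; field; by rewrite !gt_eqF.
apply: convex_comb => //; rewrite ?divr_ge0 1?ltW//.
by field; rewrite gt_eqF.
Qed.

(** A ball of radius [r] about [c] inside [K] bounds the gauge by [2 / r] times the norm;
    subadditivity turns this into a Lipschitz estimate. *)
Lemma gauge_continuous (R : realType) (K : set 'rV[R]_2) (c : 'rV[R]_2) :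
  convex_set K -> interior K c -> continuous (gauge K c).
Proof.
move=> cK ic.
have [r r0 H] := (interiorP _ _).1 ic.
have lip u : gauge K c u <= 2 / r * `|u|.
  have [->|u0] := eqVneq u 0.
    rewrite normr0 mulr0; apply/ler_addgt0Pr => e e0; rewrite add0r.
    by apply: gauge_le => //; rewrite scaler0 addr0; exact: interior_subset.
  have nu : 0 < `|u| by rewrite normr_gt0.
  have s0 : 0 < 2 / r * `|u| by rewrite mulr_gt0// divr_gt0.
  apply: gauge_le => //; apply: H; rewrite normrZ gtr0_norm ?invr_gt0//.
  rewrite -[ltLHS](_ : r / 2 = _); last by field; rewrite !gt_eqF.
  by rewrite ltr_pdivrMr// ltr_pMr// ltr1n.
have half u w : gauge K c u - gauge K c w <= 2 / r * `|w - u|.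
  rewrite lerBlDl distrC.
  rewrite -[X in gauge K c X <= _](_ : w + (u - w) = u); last by rewrite addrC subrK.
  by rewrite (le_trans (gaugeD _ _ cK ic))// lerD2l.
move=> v A /nbhs_normP [e /= e0 HA]; apply/nbhs_rV2.
have d0 : 0 < e / (2 / r) by rewrite divr_gt0// divr_gt0.
exists (e / (2 / r)) => //= w; rewrite ltr_pdivlMr ?divr_gt0// => vw.
apply: HA; rewrite /ball_ /=.
apply: le_lt_trans vw; rewrite mulrC ler_norml; apply/andP; split.
  rewrite lerNl opprB; exact: half.
by rewrite (le_trans (half _ _))// distrC.
Qed.

Definition radial (R : realType) (K : set 'rV[R]_2) (c v : 'rV[R]_2) :=
  c + (gauge K c v)^-1 *: v.

Lemma radial_boundary (R : realType) (K : set 'rV[R]_2) (c v : 'rV[R]_2) :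
  convex_body K -> interior K c -> v != 0 -> boundary K (radial K c v).
Proof.
move=> bK ic v0; have cl := body_closed bK; case: (bK) => _ cK _.
have g0 := gauge_gt0 bK ic v0.
apply/boundary_closed => //; split; last first.
  (* From an interior point one could go further out along [v], so a scale smaller than the gauge
     would be admissible. *)
  move=> /interiorP [r r0 H]; rewrite /radial in H.
  have nv : 0 < `|v| by rewrite normr_gt0.
  set d := r / (2 * `|v|).
  have dv0 : 0 < d by rewrite divr_gt0// mulr_gt0.
  set s := ((gauge K c v)^-1 + d)^-1.
  have gd0 : 0 < (gauge K c v)^-1 + d by rewrite addr_gt0// invr_gt0.
  have s0 : 0 < s by rewrite invr_gt0.
  have : gauge K c v <= s.
    apply: gauge_le => //; rewrite invrK scalerDl addrA; apply: H.
    rewrite normrZ gtr0_norm// /d.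
    rewrite -[ltLHS](_ : r / 2 = _); last by field; rewrite !gt_eqF.
    by rewrite ltr_pdivrMr// ltr_pMr// ltr1n.
  by rewrite -[leLHS]invrK lef_pV2 ?posrE ?invr_gt0// gerDl leNgt dv0.
(* If the point were outside the closed set [K], so would be slightly closer points on the ray; but
   these belong to scales above the gauge, hence to [K]. *)
apply: contrapT => nK.
have : open (~` K) by exact: closed_openC.
rewrite openE => /(_ _ nK) /interiorP [r r0 H].
set g := gauge K c v in g0 H *.
have nv : 0 < `|v| by rewrite normr_gt0.
(* The first bound keeps [g^-1 - d] positive, the second keeps the displaced point in the ball of
   radius [r] that misses [K]. *)
set d := Num.min (g^-1) (r / `|v|) / 2.
have dv0 : 0 < d by rewrite divr_gt0// lt_min invr_gt0 g0 divr_gt0.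
have d1 : d < g^-1.
  have := ge_min (g^-1) (g^-1) (r / `|v|); rewrite lexx /= => h.
  have : 0 < g^-1 by rewrite invr_gt0.
  by rewrite /d; lra.
have d2 : d < r / `|v|.
  have := ge_min (r / `|v|) (g^-1) (r / `|v|); rewrite lexx orbT /= => h.
  have : 0 < r / `|v| by rewrite divr_gt0.
  by rewrite /d; lra.
have gs : g < (g^-1 - d)^-1.
  by rewrite -[ltLHS]invrK ltf_pV2 ?posrE ?invr_gt0 ?subr_gt0// gtrBl.
have := gauge_lt cK ic gs; rewrite invrK scalerBl addrA; apply: H.
by rewrite normrN normrZ gtr0_norm// -ltr_pdivlMr.
Qed.

(** Were the gauge of [x - c] below 1, [x] would lie strictly between [c] and a point of [K] further
    out on the ray, and so be interior. *)
Lemma gauge_boundary (R : realType) (K : set 'rV[R]_2) (c x : 'rV[R]_2) :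
  convex_body K -> interior K c -> boundary K x -> gauge K c (x - c) = 1.
Proof.
move=> bK ic /boundary_closed - /(_ (body_closed bK)) [Kx nx].
case: (bK) => _ cK _.
have v0 : x - c != 0 by apply/eqP => /subr0_eq xc; apply: nx; rewrite xc.
apply/eqP; rewrite eq_le; apply/andP; split.
  by apply: gauge_le => //; rewrite invr1 scale1r addrC subrK.
rewrite leNgt; apply/negP => g1; apply: nx.
set s := (gauge K c (x - c) + 1) / 2.
have g0 := gauge_gt0 bK ic v0.
have s0 : 0 < s by rewrite /s; lra.
apply: (@interior_comb _ K c (c + s^-1 *: (x - c)) x (1 - s) s) => //.
- by apply: gauge_lt => //; rewrite /s; lra.
- by rewrite /s; lra.
- exact: ltW.
- by ring.
- by apply/rowP => i; rewrite !mxE; field; rewrite gt_eqF.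
Qed.

Lemma radialK (R : realType) (K : set 'rV[R]_2) (c x : 'rV[R]_2) :
  convex_body K -> interior K c -> boundary K x -> radial K c (x - c) = x.
Proof.
by move=> bK ic bx; rewrite /radial (gauge_boundary bK ic bx) invr1 scale1r addrC subrK.
Qed.

(** * Connectedness of radially projected paths *)

Lemma radial_path_mem (R : realType) (K K1 K2 : set 'rV[R]_2)
    (c u v : 'rV[R]_2) :
  convex_body K -> interior K c -> closed K1 -> closed K2 -> K = K1 `|` K2 ->
  (forall t, 0 <= t <= 1 -> (1 - t) *: u + t *: v != 0) ->
  (forall t, 0 <= t <= 1 ->
     ~ (K1 `&` K2) (radial K c ((1 - t) *: u + t *: v))) ->
  K1 (radial K c u) -> K1 (radial K c v).
Proof.
move=> bK ic c1 c2 K12 nz avoid K1u; case: (bK) => _ cK _.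
pose path (t : R) : 'rV[R]_2 := (1 - t) *: u + t *: v.
pose g t := radial K c (path t).
have path_cont : continuous path.
  by move=> t; apply: cvgD; apply: cvgZr_tmp; [apply: cvgB; [exact: cvg_cst|]|]; exact: cvg_id.
have g_cont : {within `[0, 1], continuous g}.
  apply: continuous_in_subspaceT => t /set_mem ht.
  have t01 : 0 <= t <= 1 by move: ht; rewrite /= in_itv.
  have g0 : gauge K c (path t) != 0 by rewrite gt_eqF// gauge_gt0// nz.
  have gt : gauge K c (path x) @[x --> t] --> gauge K c (path t).
    apply: (@continuous_comp _ _ _ path (gauge K c)); first exact: (path_cont t).
    exact: gauge_continuous.
  exact: cvgD (cvg_cst c) (cvgZ (cvgV g0 gt) (path_cont t)).
have conn := connected_continuous_connected (@segment_connected R 0 1) g_cont.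
have gK t : 0 <= t <= 1 -> K (g t).
  move=> /nz ht.
  exact: (proj1 ((boundary_closed _ (body_closed bK)).1 (radial_boundary bK ic ht))).
have g0 : g 0 = radial K c u by rewrite /g /path subr0 scale1r scale0r addr0.
have g1 : g 1 = radial K c v by rewrite /g /path subrr scale1r scale0r add0r.
set G := g @` `[0, 1] in conn.
(* On the connected set [G], which misses the intersection of the pieces, [K1] agrees with the
   complement of [K2]. Its trace is thus nonempty, relatively open and relatively closed. *)
have GI : G `&` K1 = G.
  apply: conn; first by exists (radial K c u); split => //; exists 0 => //=; rewrite in_itv/= lexx ler01.
    exists (~` K2); first exact: closed_openC.
    apply/seteqP; split => x [[t /=]]; rewrite in_itv/= => t01 <- h.
      split; first by exists t => //=; rewrite in_itv.
      by move=> h2; exact: (avoid t t01).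
    split; first by exists t => //=; rewrite in_itv.
    by have := gK t t01; rewrite K12 => -[|/h].
  by exists K1.
have : G (radial K c v) by exists 1 => //=; rewrite in_itv/= lexx ler01.
by rewrite -GI => -[].
Qed.

(** * The cross product and the two boundary arcs between [p] and [q] *)

Lemma crossDr (R : realType) (u v w : 'rV[R]_2) :
  cross u (v + w) = cross u v + cross u w.
Proof. by rewrite /cross !mxE; ring. Qed.

Lemma crossDl (R : realType) (u v w : 'rV[R]_2) :
  cross (u + v) w = cross u w + cross v w.
Proof. by rewrite /cross !mxE; ring. Qed.

Lemma crossZr (R : realType) (a : R) (u v : 'rV[R]_2) :
  cross u (a *: v) = a * cross u v.
Proof. by rewrite /cross !mxE; ring. Qed.

Lemma crossZl (R : realType) (a : R) (u v : 'rV[R]_2) :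
  cross (a *: u) v = a * cross u v.
Proof. by rewrite /cross !mxE; ring. Qed.

Lemma crossC (R : realType) (u v : 'rV[R]_2) : cross u v = - cross v u.
Proof. by rewrite /cross; ring. Qed.

Lemma cross_self (R : realType) (u : 'rV[R]_2) : cross u u = 0.
Proof. by rewrite /cross; ring. Qed.

Lemma cross_r0 (R : realType) (u : 'rV[R]_2) : cross u 0 = 0.
Proof. by rewrite /cross !mxE; ring. Qed.

Lemma cross_0r (R : realType) (u : 'rV[R]_2) : cross 0 u = 0.
Proof. by rewrite /cross !mxE; ring. Qed.

(* The directions lying on neither of the rays spanned by [u] and [v], when
   [0 < cross u v]. *)
Definition off_rays (R : realType) (u v w : 'rV[R]_2) : Prop :=
  [\/ cross u w < 0, cross w v < 0 | 0 < cross u w /\ 0 < cross w v].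

(** A direction projecting to [p] or [q] is a positive multiple of [p - c] or [q - c]; one of the
    two cross products then vanishes and the other is positive. *)
Lemma off_rays_radial (R : realType) (K : set 'rV[R]_2) (c p q w : 'rV[R]_2) :
  convex_body K -> interior K c -> 0 < cross (p - c) (q - c) ->
  off_rays (p - c) (q - c) w ->
  [/\ w != 0, radial K c w <> p & radial K c w <> q].
Proof.
move=> bK ic pq0 off.
have w0 : w != 0.
  apply/eqP => w0; move: off; rewrite w0 /off_rays cross_r0 cross_0r ltxx.
  by case=> // -[].
have g0 := gauge_gt0 bK ic w0.
have rad x : radial K c w = x -> w = gauge K c w *: (x - c).
  by move=> <-; rewrite /radial addrAC subrr add0r scalerA divff ?gt_eqF// scale1r.
split=> // /rad; move: (gauge K c w) g0 => s s0 e; move: off;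
  rewrite /off_rays e !(crossZr, crossZl) cross_self mulr0 ltxx.
- by case=> [//||[//]]; rewrite ltNge ltW// mulr_gt0.
- by case=> [|//|[//]]; rewrite ltNge ltW// mulr_gt0.
Qed.

Lemma arc_mem (R : realType) (K K1 K2 : set 'rV[R]_2) (c p q u x : 'rV[R]_2) :
  convex_body K -> interior K c -> closed K1 -> closed K2 -> K = K1 `|` K2 ->
  (forall y, boundary K y -> K1 y -> K2 y -> y = p \/ y = q) ->
  0 < cross (p - c) (q - c) -> boundary K x ->
  (forall t, 0 <= t <= 1 ->
     off_rays (p - c) (q - c) ((1 - t) *: u + t *: (x - c))) ->
  K1 (radial K c u) -> K1 x.
Proof.
move=> bK ic c1 c2 K12 K12pq pq0 bx off K1u.
rewrite -(radialK bK ic bx).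
apply: (radial_path_mem bK ic c1 c2 K12 _ _ K1u) => t /off ht.
  by case: (off_rays_radial bK ic pq0 ht).
have [w0 np nq] := off_rays_radial bK ic pq0 ht.
by case=> h1 h2; case: (K12pq _ (radial_boundary bK ic w0) h1 h2).
Qed.

(** The directions of this arc form an open convex cone containing [u], so segments from [u] stay
    off the two rays. The piece containing the projection of [u] is the required one. *)
Lemma near_arc_mem (R : realType) (K K1 K2 : set 'rV[R]_2) (c p q : 'rV[R]_2) :
  convex_body K -> interior K c -> closed K1 -> closed K2 -> K = K1 `|` K2 ->
  (forall y, boundary K y -> K1 y -> K2 y -> y = p \/ y = q) ->
  0 < cross (p - c) (q - c) ->
  exists2 Ki, Ki = K1 \/ Ki = K2 &
  forall x, boundary K x -> 0 < cross (p - c) (x - c) ->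
    0 < cross (x - c) (q - c) -> Ki x.
Proof.
move=> bK ic c1 c2 K12 K12pq pq0.
pose u := (p - c) + (q - c).
have au : cross (p - c) u = cross (p - c) (q - c).
  by rewrite /u /cross !mxE; ring.
have bu : cross u (q - c) = cross (p - c) (q - c).
  by rewrite /u /cross !mxE; ring.
have off w t : 0 <= t <= 1 -> 0 < cross (p - c) w -> 0 < cross w (q - c) ->
    off_rays (p - c) (q - c) ((1 - t) *: u + t *: w).
  move=> /andP[t0 t1] a b; apply: Or33.
  have [->|tn] := eqVneq t 0.
    by rewrite subr0 scale1r scale0r addr0 au bu.
  have tp : 0 < t by rewrite lt_neqAle eq_sym tn.
  have pos (r s : R) : 0 < r -> 0 < s -> 0 < (1 - t) * r + t * s.
    move=> r0 s0; apply: ltr_wpDl; last exact: mulr_gt0.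
    by rewrite mulr_ge0 ?subr_ge0// ltW.
  by split; [rewrite crossDr !crossZr au|rewrite crossDl !crossZl bu]; exact: pos.
have u0 : off_rays (p - c) (q - c) u.
  by apply: Or33; rewrite au bu.
have [un _ _] := off_rays_radial bK ic pq0 u0.
have [Ku _] := (boundary_closed _ (body_closed bK)).1 (radial_boundary bK ic un).
have K21 : K = K2 `|` K1 by rewrite setUC.
have K21pq y : boundary K y -> K2 y -> K1 y -> y = p \/ y = q.
  by move=> by_ h2 h1; exact: K12pq.
move: (Ku); rewrite {1}K12 => -[hu|hu].
  exists K1; first by left.
  by move=> x bx a b; apply: (arc_mem bK ic c1 c2 K12 K12pq pq0 bx _ hu) => t ht; exact: off.
exists K2; first by right.
by move=> x bx a b; apply: (arc_mem bK ic c2 c1 K21 K21pq pq0 bx _ hu) => t ht; exact: off.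
Qed.

(** The directions of this arc need not form a convex set, but they are the union of two open
    half-planes that both contain [u]. Hence they are star-shaped about [u], and segments from [u]
    suffice again. *)
Lemma far_arc_mem (R : realType) (K K1 K2 : set 'rV[R]_2) (c p q : 'rV[R]_2) :
  convex_body K -> interior K c -> closed K1 -> closed K2 -> K = K1 `|` K2 ->
  (forall y, boundary K y -> K1 y -> K2 y -> y = p \/ y = q) ->
  0 < cross (p - c) (q - c) ->
  exists2 Ki, Ki = K1 \/ Ki = K2 &
  forall x, boundary K x -> cross (p - c) (x - c) < 0 \/
    cross (x - c) (q - c) < 0 -> Ki x.
Proof.
move=> bK ic c1 c2 K12 K12pq pq0.
pose u := - ((p - c) + (q - c)).
have au : cross (p - c) u < 0.
  suff -> : cross (p - c) u = - cross (p - c) (q - c) by rewrite oppr_lt0.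
  by rewrite /u /cross !mxE; ring.
have bu : cross u (q - c) < 0.
  suff -> : cross u (q - c) = - cross (p - c) (q - c) by rewrite oppr_lt0.
  by rewrite /u /cross !mxE; ring.
have off w t : 0 <= t <= 1 -> cross (p - c) w < 0 \/ cross w (q - c) < 0 ->
    off_rays (p - c) (q - c) ((1 - t) *: u + t *: w).
  move=> /andP[t0 t1] ab.
  have [->|tn] := eqVneq t 0.
    by rewrite subr0 scale1r scale0r addr0; apply: Or31.
  have tp : 0 < t by rewrite lt_neqAle eq_sym tn.
  have neg (r s : R) : r < 0 -> s < 0 -> (1 - t) * r + t * s < 0.
    move=> r0 s0; rewrite ltr_wnDl ?pmulr_rlt0//.
    by rewrite mulr_ge0_le0 ?subr_ge0// ltW.
  case: ab => h.
    by apply: Or31; rewrite crossDr !crossZr; exact: neg.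
  by apply: Or32; rewrite crossDl !crossZl; exact: neg.
have u0 : off_rays (p - c) (q - c) u by exact: Or31.
have [un _ _] := off_rays_radial bK ic pq0 u0.
have [Ku _] := (boundary_closed _ (body_closed bK)).1 (radial_boundary bK ic un).
have K21 : K = K2 `|` K1 by rewrite setUC.
have K21pq y : boundary K y -> K2 y -> K1 y -> y = p \/ y = q.
  by move=> by_ h2 h1; exact: K12pq.
move: (Ku); rewrite {1}K12 => -[hu|hu].
  exists K1; first by left.
  by move=> x bx ab; apply: (arc_mem bK ic c1 c2 K12 K12pq pq0 bx _ hu) => t ht; exact: off.
exists K2; first by right.
by move=> x bx ab; apply: (arc_mem bK ic c2 c1 K21 K21pq pq0 bx _ hu) => t ht; exact: off.
Qed.

(** * Position of a point relative to the triangle [c], [p], [q] *)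

Lemma cross_split (R : realType) (c p q x : 'rV[R]_2) :
  cross (q - p) (x - p) = cross (p - c) (q - c)
    - cross (p - c) (x - c) - cross (x - c) (q - c).
Proof. by rewrite /cross !mxE; ring. Qed.

(** Cramer's rule in the basis [p - c], [q - c]. Together with [cross_split] it shows that the line
    [pq] is where the two coordinates sum to 1, with [c] on the side of smaller sums. *)
Lemma cone_coords (R : realType) (c p q x : 'rV[R]_2) :
  cross (p - c) (q - c) != 0 ->
  x = c + (cross (x - c) (q - c) / cross (p - c) (q - c)) *: (p - c)
        + (cross (p - c) (x - c) / cross (p - c) (q - c)) *: (q - c).
Proof.
move=> h; apply: rV2P; rewrite !mxE; move: h; rewrite /cross !mxE => h; field.
all: exact: h.
Qed.

(** With both cone coordinates nonnegative, [x] would lie in the triangle [c], [p], [q] off the side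
    [pq]. It would then be a combination of [c], with positive weight, and a point of [pq], hence
    interior. *)
Lemma above_chord_far (R : realType) (K : set 'rV[R]_2) (c p q x : 'rV[R]_2) :
  convex_body K -> interior K c -> K p -> K q ->
  0 < cross (p - c) (q - c) -> boundary K x -> 0 < cross (q - p) (x - p) ->
  cross (p - c) (x - c) < 0 \/ cross (x - c) (q - c) < 0.
Proof.
move=> bK ic Kp Kq pq0 bx fx.
have [Kx nx] := (boundary_closed _ (body_closed bK)).1 bx.
case: (bK) => _ cK _; have Kc := interior_subset ic.
have [a0|a0] := ltrP (cross (p - c) (x - c)) 0; first by left.
have [b0|b0] := ltrP (cross (x - c) (q - c)) 0; first by right.
exfalso; apply: nx.
have e := cone_coords x (lt0r_neq0 pq0).
rewrite (cross_split c) in fx.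
move: fx a0 b0 e pq0.
set D := cross (p - c) (q - c); set b := cross (p - c) (x - c).
set a := cross (x - c) (q - c) => fx b0 a0 e D0.
(* When [x] is [c] itself, the ray from [c] through [x], which is to meet [pq], is undefined. *)
have [ab|ab] := eqVneq (a + b) 0.
  have -> : x = c; last exact: ic.
  have [a00 b00] : a = 0 /\ b = 0 by split; lra.
  by rewrite e a00 b00 mul0r !scale0r !addr0.
have abp : 0 < a + b by rewrite lt_neqAle eq_sym ab addr_ge0.
apply: (@interior_comb _ K c ((a / (a + b)) *: p + (b / (a + b)) *: q) x
         (1 - (a + b) / D) ((a + b) / D)) => //.
- apply: convex_comb => //; rewrite ?divr_ge0 ?(ltW abp)//.
  by rewrite -mulrDl divff.
- by rewrite subr_gt0 ltr_pdivrMr// mul1r; lra.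
- by rewrite divr_ge0// ltW.
- by rewrite subrK.
- rewrite {1}e; apply/rowP => i; rewrite !mxE; field; by rewrite ab gt_eqF.
Qed.

Lemma below_chord_near (R : realType) (K : set 'rV[R]_2) (c p q x : 'rV[R]_2) :
  convex_body K -> interior K c -> boundary K p -> boundary K q ->
  0 < cross (p - c) (q - c) -> K x -> cross (q - p) (x - p) < 0 ->
  0 < cross (p - c) (x - c) /\ 0 < cross (x - c) (q - c).
Proof.
move=> bK ic bp bq pq0 Kx fx.
have [Kp np] := (boundary_closed _ (body_closed bK)).1 bp.
have [Kq nq] := (boundary_closed _ (body_closed bK)).1 bq.
case: (bK) => _ cK _; have Kc := interior_subset ic.
have e := cone_coords x (lt0r_neq0 pq0).
rewrite (cross_split c) in fx.
move: fx e pq0.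
set D := cross (p - c) (q - c); set b := cross (p - c) (x - c).
set a := cross (x - c) (q - c) => fx e D0.
(* If one coordinate were nonpositive, [p] or [q] would lie in the triangle
   spanned by [c], [x] and the other one, off the side opposite to [c]. *)
have key (y z : 'rV[R]_2) (r s : R) : K y -> ~ interior K z -> r <= 0 ->
    D < r + s -> x = c + (r / D) *: (y - c) + (s / D) *: (z - c) -> False.
  move=> Ky nz r0 rs ex; apply: nz.
  have s0 : 0 < s by lra.
  have Dr : 0 < D - r by lra.
  apply: (@interior_comb _ K c
     ((D / (D - r)) *: x + (- r / (D - r)) *: y) z
     (1 - (D - r) / s) ((D - r) / s)) => //.
  - apply: convex_comb => //; rewrite ?divr_ge0 ?(ltW Dr) ?(ltW D0) ?oppr_ge0//.
    by rewrite -mulrDl divff// gt_eqF.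
  - by rewrite subr_gt0 ltr_pdivrMr// mul1r; lra.
  - by rewrite divr_ge0// ltW.
  - by rewrite subrK.
  - rewrite ex; apply/rowP => i; rewrite !mxE; field; by rewrite !gt_eqF.
split; rewrite ltNge; apply/negP => h.
  by apply: (key q p b a) => //; [lra|rewrite {1}e addrAC].
by apply: (key p q a b) => //; lra.
Qed.

(** * Segments with ends in a set: effect on diameter and width *)

Definition chord_hull (R : realType) (S : set 'rV[R]_2) : set 'rV[R]_2 :=
  [set x | exists y z, [/\ S y, S z & segment y z x]].

Lemma dot2 (R : realType) (x y : 'rV[R]_2) :
  dot x y = x 0 0 * y 0 0 + x 0 1 * y 0 1.
Proof.
rewrite /dot big_ord_recl big_ord1; congr (_ + _ * _).
all: by congr (fun_of_matrix _ _ _); apply/val_inj.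
Qed.

Lemma enorm_le (R : realType) (x : 'rV[R]_2) (d : R) :
  0 <= d -> (enorm x <= d) = (dot x x <= d ^+ 2).
Proof.
by move=> d0; rewrite /enorm -{1}(ger0_norm d0) -sqrtr_sqr ler_sqrt// sqr_ge0.
Qed.

(** Convexity of the Euclidean ball comes from the identity |ax + by|^2 = a|x|^2 + b|y|^2 - ab|x -
    y|^2 for a + b = 1. *)
Lemma enorm_comb_le (R : realType) (x y : 'rV[R]_2) (a b d : R) :
  0 <= a -> 0 <= b -> a + b = 1 -> enorm x <= d -> enorm y <= d ->
  enorm (a *: x + b *: y) <= d.
Proof.
move=> a0 b0 ab xd yd; have d0 : 0 <= d := le_trans (sqrtr_ge0 _) xd.
move: xd yd; rewrite !enorm_le// => xd yd.
have e : dot (a *: x + b *: y) (a *: x + b *: y)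
    = a * dot x x + b * dot y y - a * b * dot (x - y) (x - y).
  by have -> : b = 1 - a; [lra|rewrite !dot2 !mxE; ring].
have s : 0 <= a * b * dot (x - y) (x - y).
  by rewrite !mulr_ge0// dot2 addr_ge0// -expr2 sqr_ge0.
have : a * dot x x + b * dot y y <= a * d ^+ 2 + b * d ^+ 2.
  by rewrite lerD// ler_wpM2l.
by rewrite -mulrDl ab mul1r e; lra.
Qed.

Lemma norm_coord_le (R : realType) (x : 'rV[R]_2) (i : 'I_2) : `|x 0 i| <= `|x|.
Proof.
rewrite [leRHS]/Num.norm/= mx_normrE.
exact: (le_bigmax _ (fun ij : 'I_1 * 'I_2 => `|x ij.1 ij.2|) (0, i)).
Qed.

(** The bounds on [x] and [y] are in the sup norm: each coordinate of the difference is at most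
    [2 * M], so the squared length is at most 8M^2. The lemma serves to show that the supremum in
    [diameter] is over a bounded set. *)
Lemma enorm_sub_le (R : realType) (x y : 'rV[R]_2) (M : R) :
  0 <= M -> `|x| <= M -> `|y| <= M -> enorm (x - y) <= 4 * M.
Proof.
move=> M0 xM yM; rewrite enorm_le ?mulr_ge0// dot2 -!expr2.
have h i : (x - y) 0 i ^+ 2 <= (2 * M) ^+ 2.
  rewrite -[leLHS]real_normK ?num_real// lerXn2r ?nnegrE ?mulr_ge0//.
  rewrite (le_trans (norm_coord_le _ _))// (le_trans (ler_normB _ _))//.
  lra.
have -> : (4 * M) ^+ 2 = 4 * (2 * M) ^+ 2 by ring.
by have := h 0; have := h 1; have := sqr_ge0 (2 * M); lra.
Qed.

(** The distance to a fixed point is convex, so on a segment it is largest at an end. This is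
    applied to the two points one after the other. *)
Lemma diameter_chord_hull (R : realType) (S T : set 'rV[R]_2) (M : R) :
  0 <= M -> (forall x, S x -> `|x| <= M) -> T !=set0 -> T `<=` chord_hull S ->
  diameter T <= diameter S.
Proof.
move=> M0 SM [t0 Tt0] TS.
have D x y : S x -> S y -> enorm (x - y) <= diameter S.
  move=> Sx Sy; apply: ub_le_sup; last by exists x, y.
  by exists (4 * M) => _ [x' [y' [/SM xM /SM yM ->]]]; exact: enorm_sub_le.
apply: ge_sup; first by exists (enorm (t0 - t0)), t0, t0.
move=> _ [x [y [/TS [x1 [x2 [Sx1 Sx2 [a /= + <-]]]]
                /TS [y1 [y2 [Sy1 Sy2 [b /= + <-]]]] ->]]].
rewrite !in_itv/= => /andP[a0 a1] /andP[b0 b1].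
have left z : S z -> enorm (z - ((1 - b) *: y1 + b *: y2)) <= diameter S.
  move=> Sz.
  have -> : z - ((1 - b) *: y1 + b *: y2) = (1 - b) *: (z - y1) + b *: (z - y2).
    by apply/rowP => i; rewrite !mxE; ring.
  by apply: enorm_comb_le; [lra|lra|ring|exact: D|exact: D].
rewrite /Defs.edist; set w := (1 - b) *: y1 + b *: y2 in left *.
have -> : (1 - a) *: x1 + a *: x2 - w = (1 - a) *: (x1 - w) + a *: (x2 - w).
  by apply/rowP => i; rewrite !mxE; ring.
by apply: enorm_comb_le; [lra|lra|ring|exact: left|exact: left].
Qed.

Lemma dot_comb (R : realType) (u x y : 'rV[R]_2) (a b : R) :
  dot u (a *: x + b *: y) = a * dot u x + b * dot u y.
Proof. by rewrite !dot2 !mxE; ring. Qed.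

(** A strip containing [S] is convex, so it contains every segment with ends in [S]. *)
Lemma width_chord_hull (R : realType) (S T : set 'rV[R]_2) (M : R) :
  0 <= M -> (forall x, S x -> `|x| <= M) -> T `<=` chord_hull S ->
  width T <= width S.
Proof.
move=> M0 SM TS; apply: lb_le_inf.
  (* The strip bounding the first coordinate by [M] shows that the infimum for [S] is over a
     nonempty set. *)
  exists (M - - M), (delta_mx 0 0), (- M), M; split => //.
  - by rewrite /enorm dot2 !mxE/= mulr0 addr0 mulr1 sqrtr1.
  - lra.
  - move=> x /SM xM; rewrite dot2 !mxE/= mul0r addr0 mul1r -ler_norml.
    exact: le_trans (norm_coord_le _ _) xM.
move=> _ [u [a [b [u1 ab Sab ->]]]]; apply: ge_inf.
  by exists 0 => _ [_ [a' [b' [_ ab' _ ->]]]]; rewrite subr_ge0.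
exists u, a, b; split => // x /TS [y [z [/Sab/andP[y1 y2] /Sab/andP[z1 z2]]]].
move=> [t /=]; rewrite in_itv/= => /andP[t0 t1] <-; rewrite dot_comb.
have t1' : 0 <= 1 - t by rewrite subr_ge0.
have e z0 : z0 = (1 - t) * z0 + t * z0 by ring.
by apply/andP; split; [rewrite [leLHS]e|rewrite [leRHS]e]; rewrite lerD// ler_wpM2l.
Qed.

(** * Chords of a body and the bisections they give *)

Lemma chord_through (R : realType) (K : set 'rV[R]_2) (x d : 'rV[R]_2) :
  convex_body K -> K x -> d != 0 ->
  exists s t : R, [/\ boundary K (x + s *: d), boundary K (x - t *: d)
    & segment (x + s *: d) (x - t *: d) x].
Proof.
move=> bK Kx d0; have [ix|nx] := pselect (interior K x); last first.
  (* A boundary point serves as its own degenerate chord. *)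
  exists 0, 0; rewrite !scale0r subr0 addr0.
  have bx : boundary K x by apply/(boundary_closed _ (body_closed bK)).
  split => //; exists 0; first by rewrite /= in_itv/= lexx ler01.
  by rewrite subr0 scale1r scale0r addr0.
have nd0 : - d != 0 by rewrite oppr_eq0.
have s0 : 0 < (gauge K x d)^-1 by rewrite invr_gt0 gauge_gt0.
have t0 : 0 < (gauge K x (- d))^-1 by rewrite invr_gt0 gauge_gt0.
have bs := radial_boundary bK ix d0.
have bt := radial_boundary bK ix nd0.
move: bs bt; rewrite /radial scalerN.
move: (gauge K x d)^-1 (gauge K x (- d))^-1 s0 t0 => s t s0 t0 bs bt.
exists s, t; split; [exact: bs|exact: bt|exists (s / (s + t))].
  rewrite /= in_itv/= divr_ge0 ?addr_ge0 ?(ltW s0) ?(ltW t0)//=.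
  by rewrite ler_pdivrMr ?addr_gt0// mul1r lerDl ltW.
by apply/rowP => i; rewrite !mxE; field; rewrite gt_eqF// addr_gt0.
Qed.

Lemma cross_continuous (R : realType) (u p : 'rV[R]_2) :
  continuous (fun x : 'rV[R]_2 => cross u (x - p)).
Proof.
have -> : (fun x : 'rV[R]_2 => cross u (x - p))
    = (fun x : 'rV[R]_2 => u 0 0 * x 0 1 + (- u 0 1) * x 0 0 - cross u p).
  by apply/funext => x; rewrite /cross !mxE; ring.
move=> x; exact: (cvgB (cvgD (cvgM (cvg_cst _) (@coord_continuous _ _ _ 0 1 x))
  (cvgM (cvg_cst _) (@coord_continuous _ _ _ 0 0 x))) (cvg_cst _)).
Qed.

(** The interior point [m] on the chord excludes a chord running inside the boundary. It makes all
    points strictly between [p] and [q] interior, and it keeps [K] from meeting the line [pq] beyond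
    its ends. *)
Lemma chord_bisection (R : realType) (K : set 'rV[R]_2) (p q m : 'rV[R]_2)
    (mu : R) :
  convex_body K -> boundary K p -> boundary K q -> 0 < mu < 1 ->
  m = (1 - mu) *: p + mu *: q -> interior K m ->
  let A := K `&` [set x | 0 <= cross (q - p) (x - p)] in
  let B := K `&` [set x | cross (q - p) (x - p) <= 0] in
  bisection K A B /\ A `&` B = segment p q.
Proof.
move=> bK bp bq /andP[mu0 mu1] em im A B.
have clK := body_closed bK; case: (bK) => _ cK _.
have [Kp np] := (boundary_closed _ clK).1 bp.
have [Kq nq] := (boundary_closed _ clK).1 bq.
have pq : q - p != 0.
  apply/eqP => /subr0_eq qp; apply: np; rewrite -(_ : m = p) // em qp.
  by rewrite -scalerDl subrK scale1r.
(* Such a point lies on the segment from [m] to [p] or from [m] to [q], with positive weight at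
   [m]. *)
have inside t : 0 < t -> t < 1 -> interior K ((1 - t) *: p + t *: q).
  move=> t0 t1; have [tm|tm] := lerP t mu.
    apply: (@interior_comb _ K m p _ (t / mu) (1 - t / mu)) => //.
    - exact: divr_gt0.
    - by rewrite subr_ge0 ler_pdivrMr// mul1r.
    - by ring.
    - by apply/rowP => i; rewrite em !mxE; field; rewrite gt_eqF.
  have m1 : 0 < 1 - mu by lra.
  apply: (@interior_comb _ K m q _ ((1 - t) / (1 - mu)) ((t - mu) / (1 - mu))) => //.
  - by rewrite divr_gt0// subr_gt0.
  - by rewrite divr_ge0 ?(ltW m1)// subr_ge0 ltW.
  - by field; rewrite gt_eqF.
  - by apply/rowP => i; rewrite em !mxE; field; rewrite gt_eqF.
have onseg t : 0 <= t <= 1 -> K ((1 - t) *: p + t *: q).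
  by move=> /andP[t0 t1]; apply: convex_comb => //; rewrite ?subr_ge0// subrK.
have capE : A `&` B = segment p q.
  apply/seteqP; split => x.
    move=> [[Kx /= f1] [_ /= f2]].
    have f0 : cross (q - p) (x - p) = 0 by apply/eqP; rewrite eq_le f1 f2.
    (* The parameter is read off from a coordinate in which [q - p] does not vanish. *)
    have [t et] : exists t, x = (1 - t) *: p + t *: q.
      have [h|h] := eqVneq ((q - p) 0 0) 0.
        have h1 : (q - p) 0 1 != 0.
          by apply: contra pq => /eqP h1; apply/eqP/rV2P; rewrite [RHS]mxE.
        exists ((x - p) 0 1 / (q - p) 0 1).
        move: f0 h h1; rewrite /cross !mxE => f0 h h1.
        apply: rV2P; rewrite !mxE; last by field.
        move: f0; rewrite h mul0r sub0r => /eqP; rewrite oppr_eq0 mulf_eq0.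
        rewrite (negbTE h1)/= subr_eq0 => /eqP ->.
        have -> : q 0 0 = p 0 0 by lra.
        by ring.
      exists ((x - p) 0 0 / (q - p) 0 0).
      move: f0 h; rewrite /cross !mxE => f0 h.
      apply: rV2P; rewrite !mxE; first by field.
      have -> : x 0 1 = p 0 1 + (q 0 1 - p 0 1) * (x 0 0 - p 0 0) / (q 0 0 - p 0 0).
        have -> : (q 0 1 - p 0 1) * (x 0 0 - p 0 0)
            = (q 0 0 - p 0 0) * (x 0 1 - p 0 1) by lra.
        by field.
      by field.
    (* A parameter below 0 would place [p] strictly between [m] and [x], one above 1 would do so for
       [q]; that end would then be interior. *)
    exists t => //=; rewrite in_itv/=; apply/andP; split; rewrite leNgt; apply/negP => ht.
      apply: np; apply: (@interior_comb _ K m x _ (- t / (mu - t)) (mu / (mu - t))) => //.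
      - by rewrite divr_gt0; lra.
      - by rewrite divr_ge0; lra.
      - by field; rewrite gt_eqF//; lra.
      - by apply/rowP => i; rewrite em et !mxE; field; rewrite gt_eqF//; lra.
    apply: nq; apply: (@interior_comb _ K m x _ ((t - 1) / (t - mu)) ((1 - mu) / (t - mu))) => //.
    - by rewrite divr_gt0; lra.
    - by rewrite divr_ge0; lra.
    - by field; rewrite gt_eqF//; lra.
    - by apply/rowP => i; rewrite em et !mxE; field; rewrite gt_eqF//; lra.
  move=> [t /=]; rewrite in_itv/= => t01 <-.
  have f0 : cross (q - p) ((1 - t) *: p + t *: q - p) = 0.
    by rewrite /cross !mxE; ring.
  by split; split; rewrite /= ?f0//; exact: onseg.
split=> //.
split.
- apply: closedI => //; apply: (@closed_comp _ _ _ [set y : R | 0 <= y]); last exact: closed_ge.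
  by move=> x _; exact: cross_continuous.
- apply: closedI => //; apply: (@closed_comp _ _ _ [set y : R | y <= 0]); last exact: closed_le.
  by move=> x _; exact: cross_continuous.
- apply/seteqP; split => x; last by case=> -[].
  by move=> Kx; case: (lerP 0 (cross (q - p) (x - p))) => h; [left|right; split => //=; exact: ltW].
pose l (t : R) : 'rV[R]_2 := (1 - (t + 1) / 2) *: p + ((t + 1) / 2) *: q.
have l01 (t : R) : t \in `[-1, 1] -> 0 <= (t + 1) / 2 <= 1.
  by rewrite in_itv/= => /andP[? ?]; apply/andP; split; lra.
exists l; split; last first.
  rewrite capE; apply/seteqP; split => x [t /= ht <-].
    exists (2 * t - 1).
      by move: ht; rewrite /= !in_itv/= => /andP[? ?]; apply/andP; split; lra.
    by rewrite /l; have -> : (2 * t - 1 + 1) / 2 = t by field.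
  by exists ((t + 1) / 2); first by have := l01 t ht; rewrite /= in_itv.
split.
- apply: continuous_subspaceT => t; apply: cvgD; apply: cvgZr_tmp.
    apply: cvgB; first exact: cvg_cst.
    by apply: cvgM; [apply: cvgD; [exact: cvg_id|exact: cvg_cst]|exact: cvg_cst].
  by apply: cvgM; [apply: cvgD; [exact: cvg_id|exact: cvg_cst]|exact: cvg_cst].
- move=> s t _ _ est.
  have : ((s - t) / 2) *: (q - p) = 0.
    have -> : ((s - t) / 2) *: (q - p) = l s - l t.
      by apply/rowP => i; rewrite !mxE; field.
    by rewrite est subrr.
  move/eqP; rewrite scaler_eq0 (negbTE pq) orbF => /eqP; lra.
- by move=> _ [t /l01 ht <-]; exact: onseg.
- move=> t ht; split.
    move=> /(boundary_closed _ clK) [_ nl].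
    have := ht; rewrite in_itv/= => /andP[t1 t2].
    have [->|tn1] := eqVneq t (-1); first by left.
    have [->|tn2] := eqVneq t 1; first by right.
    have a1 : -1 < t by rewrite lt_neqAle eq_sym tn1.
    have a2 : t < 1 by rewrite lt_neqAle tn2.
    by exfalso; apply: nl; apply: inside; lra.
  case=> ->; rewrite /l.
    by rewrite addNr mul0r subr0 scale1r scale0r addr0.
  by rewrite divff// subrr scale0r scale1r add0r.
Qed.

(** The chord through [x] in direction [d] has both ends on the line where the cross product
    vanishes. *)
Lemma chord_hull_chord (R : realType) (K S : set 'rV[R]_2) (x d : 'rV[R]_2) :
  convex_body K -> K x -> d != 0 ->
  (forall y, boundary K y -> cross d (y - x) = 0 -> S y) -> chord_hull S x.
Proof.
move=> bK Kx d0 H; have [s [t [bs bt xst]]] := chord_through bK Kx d0.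
exists (x + s *: d), (x - t *: d); split => //; apply: H => //.
  by rewrite /cross !mxE; ring.
by rewrite /cross !mxE; ring.
Qed.

Lemma exists_chord_bisection (R : realType) (K : set 'rV[R]_2) :
  convex_body K -> exists K1 K2, segment_bisection K K1 K2.
Proof.
move=> bK; have [_ _ [c ic]] := bK.
have v0 : delta_mx 0 0 != 0 :> 'rV[R]_2.
  apply/eqP => /(congr1 (fun v : 'rV[R]_2 => v 0 0)); rewrite !mxE/= => /eqP.
  by rewrite oner_eq0.
move: (delta_mx 0 0) v0 => v v0.
have nv0 : - v != 0 by rewrite oppr_eq0.
have s0 : 0 < (gauge K c v)^-1 by rewrite invr_gt0 gauge_gt0.
have t0 : 0 < (gauge K c (- v))^-1 by rewrite invr_gt0 gauge_gt0.
have bs := radial_boundary bK ic v0.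
have bt := radial_boundary bK ic nv0.
move: bs bt; rewrite /radial scalerN.
move: (gauge K c v)^-1 (gauge K c (- v))^-1 s0 t0 => s t s0 t0 bs bt.
have mu01 : 0 < s / (s + t) < 1.
  by rewrite divr_gt0 ?addr_gt0//= ltr_pdivrMr ?addr_gt0// mul1r ltrDl.
have ec : c = (1 - s / (s + t)) *: (c + s *: v) + (s / (s + t)) *: (c - t *: v).
  by apply/rowP => i; rewrite !mxE; field; rewrite gt_eqF// addr_gt0.
have [bis seg] := chord_bisection bK bs bt mu01 ec ic.
by do 2! eexists; split; [exact: bis|do 2! eexists; exact: seg].
Qed.

(** * Replacing the dividing curve by a chord *)

Lemma oriented_bisection (R : realType) (K K1 K2 : set 'rV[R]_2)
    (c p q : 'rV[R]_2) :
  convex_body K -> interior K c -> closed K1 -> closed K2 -> K = K1 `|` K2 ->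
  boundary K p -> boundary K q -> K1 p -> K2 p -> K1 q -> K2 q ->
  (forall y, boundary K y -> K1 y -> K2 y -> y = p \/ y = q) ->
  0 < cross (p - c) (q - c) ->
  exists K1' K2', [/\ segment_bisection K K1' K2',
    K1' `<=` chord_hull K1 \/ K1' `<=` chord_hull K2 &
    K2' `<=` chord_hull K1 \/ K2' `<=` chord_hull K2].
Proof.
move=> bK ic c1 c2 K12 bp bq K1p K2p K1q K2q K12pq pq0.
have clK := body_closed bK; case: (bK) => _ cK _.
have [Kp np] := (boundary_closed _ clK).1 bp.
have [Kq nq] := (boundary_closed _ clK).1 bq.
have [Kf Kf12 Kfar] := far_arc_mem bK ic c1 c2 K12 K12pq pq0.
have [Kn Kn12 Knear] := near_arc_mem bK ic c1 c2 K12 K12pq pq0.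
have [Kfp Kfq] : Kf p /\ Kf q by case: Kf12 => ->.
have [Knp Knq] : Kn p /\ Kn q by case: Kn12 => ->.
pose f x := cross (q - p) (x - p).
have pq : q - p != 0.
  by apply/eqP => /subr0_eq qp; move: pq0; rewrite qp cross_self ltxx.
(* [f] is constant along parallels to [pq], so the ends of such a chord lie on the same side of [pq]
   as its other points. *)
have fshift x y : cross (q - p) (y - x) = 0 -> f y = f x.
  move=> h; rewrite /f -[LHS]subr0 -h; rewrite /cross !mxE; ring.
have hull_pos x : K x -> 0 < f x -> chord_hull Kf x.
  move=> Kx fx; apply: (chord_hull_chord bK Kx pq) => y by_ /fshift fy.
  by apply: Kfar => //; apply: (above_chord_far bK ic Kp Kq) => //; rewrite -/(f y) fy.
have hull_neg x : K x -> f x < 0 -> chord_hull Kn x.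
  move=> Kx fx; apply: (chord_hull_chord bK Kx pq) => y by_ /fshift fy.
  have [Ky _] := (boundary_closed _ clK).1 by_.
  have [|a b] := below_chord_near bK ic bp bq pq0 Ky _; first by rewrite -/(f y) fy.
  exact: Knear.
have seg_hull S x : S p -> S q -> segment p q x -> chord_hull S x.
  by move=> Sp Sq h; exists p, q.
have in_hull S T : S = K1 \/ S = K2 -> T `<=` chord_hull S ->
    T `<=` chord_hull K1 \/ T `<=` chord_hull K2.
  by case=> ->; [left|right].
have [[x [Kx fx]]|Nneg] := pselect (exists x, K x /\ f x < 0).
  have [b0 a0] := below_chord_near bK ic bp bq pq0 Kx fx.
  have ex := cone_coords x (lt0r_neq0 pq0).
  move: fx; rewrite /f (cross_split c) => fx.
  move: b0 a0 ex fx.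
  set D := cross (p - c) (q - c) in pq0 *; set b := cross (p - c) (x - c).
  set a := cross (x - c) (q - c) => b0 a0 ex fx.
  have ab0 : 0 < a + b by rewrite addr_gt0.
  (* The segment from [c] to [x] crosses [pq] at this point. Since [x] is beyond the line,
     [D < a + b], so [c] has positive weight there. *)
  have im : interior K ((1 - b / (a + b)) *: p + (b / (a + b)) *: q).
    apply: (@interior_comb _ K c x _ (1 - D / (a + b)) (D / (a + b))) => //.
    - by rewrite subr_gt0 ltr_pdivrMr// mul1r; lra.
    - by rewrite divr_ge0// ltW.
    - by rewrite subrK.
    - by rewrite ex; apply/rowP => i; rewrite !mxE; field; rewrite !gt_eqF.
  have mu01 : 0 < b / (a + b) < 1.
    by rewrite divr_gt0//= ltr_pdivrMr// mul1r ltrDr.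
  have [bis seg] := chord_bisection bK bp bq mu01 erefl im.
  have flat y : K y -> f y = 0 -> segment p q y.
    by move=> Ky fy; rewrite -seg; split; split; rewrite //= -/(f y) fy.
  exists (K `&` [set y | 0 <= f y]), (K `&` [set y | f y <= 0]).
  split; first by split=> //; exists p, q.
    apply: (in_hull Kf) => // y [Ky /=]; rewrite le_eqVlt => /orP[/eqP fy|]; last exact: hull_pos.
    by apply: seg_hull => //; exact: flat.
  apply: (in_hull Kn) => // y [Ky /=]; rewrite le_eqVlt => /orP[/eqP fy|]; last exact: hull_neg.
  by apply: seg_hull => //; exact: flat.
(* From here on [K] lies in the closed half-plane of [pq] containing [c], and [Kf] alone is shown to
   generate all of [K]. *)
have Kge x : K x -> 0 <= f x.
  by move=> Kx; rewrite leNgt; apply/negP => fx; apply: Nneg; exists x.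
have fc : 0 < f c by rewrite /f (cross_split c) subrr cross_r0 cross_0r !subr0.
have diag S x : S x -> chord_hull S x.
  move=> Sx; exists x, x; split=> //; exists 0; first by rewrite /= in_itv/= lexx ler01.
  by rewrite subr0 scale1r scale0r addr0.
have hull x : K x -> chord_hull Kf x.
  move=> Kx; have := Kge x Kx; rewrite le_eqVlt => /orP[/eqP fx|]; last exact: hull_pos.
  (* From an interior point on the line [pq], moving on away from [c] would reach a point of [K]
     with negative [f]. *)
  have bx : boundary K x.
    apply/(boundary_closed _ clK); split => // ix.
    have d0 : x - c != 0.
      by apply/eqP => /subr0_eq xc; move: fc; rewrite -xc -fx ltxx.
    have g0 := gauge_gt0 bK ix d0.
    have [Ky _] := (boundary_closed _ clK).1 (radial_boundary bK ix d0).
    have := Kge _ Ky.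
    have -> : f (radial K x (x - c)) = f x + (gauge K x (x - c))^-1 * (f x - f c).
      by rewrite /f /radial /cross !mxE; ring.
    rewrite -fx add0r sub0r mulrN oppr_ge0 leNgt.
    by rewrite mulr_gt0// invr_gt0.
  have e := cone_coords x (lt0r_neq0 pq0).
  have [a0|a0] := ltrP (cross (p - c) (x - c)) 0.
    by apply/diag/Kfar => //; left.
  have [b0|b0] := ltrP (cross (x - c) (q - c)) 0.
    by apply/diag/Kfar => //; right.
  (* Both cone coordinates are nonnegative and, as [f x] is 0, they sum to 1. *)
  apply: seg_hull => //.
  move: fx; rewrite /f (cross_split c) => fx.
  move: a0 b0 e fx pq0.
  set D := cross (p - c) (q - c); set b := cross (p - c) (x - c).
  set a := cross (x - c) (q - c) => b0 a0 e fx D0.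
  exists (b / D).
    by rewrite /= in_itv/= divr_ge0 ?(ltW D0)//= ler_pdivrMr// mul1r; lra.
  rewrite [RHS]e; have -> : a = D - b by lra.
  by apply/rowP => i; rewrite !mxE; field; rewrite gt_eqF.
have [K1' [K2' sb]] := exists_chord_bisection bK.
have [_ _ KE _] := proj1 sb.
exists K1', K2'; split; first exact: sb.
  by apply: (in_hull Kf) => // y hy; apply: hull; rewrite KE; left.
by apply: (in_hull Kf) => // y hy; apply: hull; rewrite KE; right.
Qed.

(** An interior point on the line [pq] is moved off it along the normal [n], which is [q - p] turned
    by a right angle. The factor [e] makes the shift of norm [r / 2], so a ball of radius [r / 2]
    still fits. *)
Lemma interior_off_line (R : realType) (K : set 'rV[R]_2) (p q : 'rV[R]_2) :
  interior K !=set0 -> p != q ->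
  exists2 c, interior K c & cross (p - c) (q - c) != 0.
Proof.
move=> [c ic] pq; have [c0|] := eqVneq (cross (p - c) (q - c)) 0; last by exists c.
have [r r0 H] := (interiorP K c).1 ic.
pose n : 'rV[R]_2 := \row_i (if i == 0 then - (q - p) 0 1 else (q - p) 0 0).
have n2 : cross (q - p) n = (q - p) 0 0 ^+ 2 + (q - p) 0 1 ^+ 2.
  by rewrite /cross !mxE/=; ring.
have nn : cross (q - p) n != 0.
  rewrite n2 paddr_eq0 ?sqr_ge0// !sqrf_eq0; apply: contra pq => /andP[/eqP h0 /eqP h1].
  by rewrite eq_sym -subr_eq0; apply/eqP/rV2P; rewrite [RHS]mxE.
have n0 : 0 < `|n|.
  by rewrite normr_gt0; apply: contra nn => /eqP ->; rewrite cross_r0.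
pose e := r / (2 * `|n|).
have e0 : 0 < e by rewrite divr_gt0// mulr_gt0.
exists (c + e *: n); last first.
  have -> : cross (p - (c + e *: n)) (q - (c + e *: n))
      = cross (p - c) (q - c) + e * cross (q - p) n.
    by rewrite /cross !mxE/=; ring.
  by rewrite c0 add0r mulf_neq0// gt_eqF.
apply/interiorP; exists (r / 2); first by rewrite divr_gt0.
move=> v vr; rewrite -addrA; apply: H.
rewrite (le_lt_trans (ler_normD _ _))// normrZ gtr0_norm//.
have -> : e * `|n| = r / 2 by rewrite /e; field; rewrite gt_eqF.
lra.
Qed.

Lemma segment_bisection_chord_hull (R : realType) (K K1 K2 : set 'rV[R]_2) :
  convex_body K -> bisection K K1 K2 ->
  exists K1' K2', [/\ segment_bisection K K1' K2',
    K1' `<=` chord_hull K1 \/ K1' `<=` chord_hull K2 &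
    K2' `<=` chord_hull K1 \/ K2' `<=` chord_hull K2].
Proof.
move=> bK [c1 c2 K12 [l [[_ linj _ lb] Kl]]].
have m1 : (-1 : R) \in `[-1, 1] by rewrite in_itv/= lexx; lra.
have p1 : (1 : R) \in `[-1, 1] by rewrite in_itv/= lexx andbT; lra.
have on t : t \in `[-1, 1] -> K1 (l t) /\ K2 (l t).
  by move=> ht; have : (K1 `&` K2) (l t) by rewrite Kl; exists t.
have [K1p K2p] := on _ m1; have [K1q K2q] := on _ p1.
have bp : boundary K (l (-1)) by apply/lb => //; left.
have bq : boundary K (l 1) by apply/lb => //; right.
have ends y : boundary K y -> K1 y -> K2 y -> y = l (-1) \/ y = l 1.
  move=> by_ h1 h2; have : (K1 `&` K2) y by [].
  rewrite Kl => -[t /= ht e]; move: by_; rewrite -e => /(lb t ht).1.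
  by case=> ->; [left|right].
have pq : l (-1) != l 1.
  by apply/eqP => /(linj _ _ m1 p1); lra.
have [_ _ K0] := bK; have [c ic] := interior_off_line K0 pq.
(* If the orientation of [c], [p], [q] is negative, the two ends exchange roles. *)
rewrite neq_lt => /orP[h|h].
  apply: (oriented_bisection bK ic c1 c2 K12 bq bp K1q K2q K1p K2p).
    by move=> y by_ h1 h2; case: (ends y by_ h1 h2); [right|left].
  by rewrite crossC oppr_gt0.
exact: (oriented_bisection bK ic c1 c2 K12 bp bq K1p K2p K1q K2q ends).
Qed.

Theorem lemma2p1 (R : realType) (K : set 'rV[R]_2) (rho : R)
    (hK : convex_body K) (hrho : 0 < rho) :
  (forall K1 K2 : set 'rV[R]_2,
     bisection K K1 K2 ->
     Num.max (diameter K1) (diameter K2) = rho ->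
     exists K1' K2' : set 'rV[R]_2,
       segment_bisection K K1' K2' /\
       Num.max (diameter K1') (diameter K2') <= rho)
  /\
  (forall K1 K2 : set 'rV[R]_2,
     bisection K K1 K2 ->
     Num.max (width K1) (width K2) = rho ->
     exists K1' K2' : set 'rV[R]_2,
       segment_bisection K K1' K2' /\
       Num.max (width K1') (width K2') <= rho).
Proof.
have [M0 M0pos KM] := body_bounded hK; have M0ge := ltW M0pos.
have bound S K1 K2 : K = K1 `|` K2 -> S = K1 \/ S = K2 -> forall x, S x -> `|x| <= M0.
  by move=> KE hS x Sx; apply: KM; rewrite KE; case: hS => <-; [left|right].
split=> K1 K2 bis maxE.
all: have [K1' [K2' [sb h1 h2]]] := segment_bisection_chord_hull hK bis.
all: exists K1', K2'; split=> //; have [_ _ KE _] := bis.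
all: have M1 := bound K1 K1 K2 KE (or_introl erefl).
all: have M2 := bound K2 K1 K2 KE (or_intror erefl).
all: rewrite -maxE ge_max !le_max; apply/andP.
(* The diameter comparison asks for nonempty pieces; the end [p] of the chord lies in both. *)
- have [_ [p [q seg]]] := sb.
  have [K1p K2p] : (K1' `&` K2') p.
    rewrite seg; exists 0; first by rewrite /= in_itv/= lexx ler01.
    by rewrite subr0 scale1r scale0r addr0.
  have D T : T p -> T `<=` chord_hull K1 \/ T `<=` chord_hull K2 ->
      (diameter T <= diameter K1) || (diameter T <= diameter K2).
    move=> Tp [h|h]; apply/orP; [left|right].
      by apply: (diameter_chord_hull M0ge M1) => //; exists p.
    by apply: (diameter_chord_hull M0ge M2) => //; exists p.
  by split; exact: D.
- have W T : T `<=` chord_hull K1 \/ T `<=` chord_hull K2 ->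
      (width T <= width K1) || (width T <= width K2).
    by move=> [h|h]; apply/orP; [left; exact: (width_chord_hull M0ge M1)
                                |right; exact: (width_chord_hull M0ge M2)].
  by split; exact: W.
Qed.
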